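(* There exists a family of cardinality $c$ consisting of compact and totally disconnected subspaces of the Euclidean unit interval $[0,1]$ such that any two distinct members of the family are not homeomorphic.
   Context: $c$ denotes the cardinality of $\mathbb{R}$. A space is totally disconnected if each of its connected components is a singleton. *)

(* Defs.v *)
From mathcomp Require Import all_boot all_order all_algebra.
From mathcomp Require Import all_classical all_reals all_analysis.

Set Implicit Arguments.
Unset Strict Implicit.
Unset Printing Implicit Defensive.

Definition homeomorphic (X Y : topologicalType) : Prop :=
  exists (f : X -> Y) (g : Y -> X),
    [/\ cancel f g, cancel g f, continuous f & continuous g].

(* Main.v *)
(** To [f : nat -> nat] with [n < f n] attach a closed subset of the Cantor space
    2^N: a Cantor set [K] together with points [c_n] of [K] converging to a point
    of [K], where at each [c_n] one glues a countable "spike" homeomorphic to the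
    ordinal [omega ^ f n + 1], with top point [c_n].  The points of [K] lying in
    the closure of the isolated points are the [c_n], whose Cantor-Bendixson rank
    in that closure is exactly [f n], and the limit point, at which all derivatives
    persist because [f] is unbounded.  The ranks of points that are also limits of
    points away from the isolated ones thus form the range of [f], a topological
    invariant.  Coding the Dedekind cut of a real [r] by the choice, for each [n],
    between [2n+1] and [2n+2] in the range of [f] gives one space per real; they
    are embedded in [0, 1] by ternary expansions with digits 0 and 2. *)

Require Import Defs.
From mathcomp Require Import all_boot all_order all_algebra.
From mathcomp Require Import all_classical all_reals all_analysis.
From mathcomp Require Import lra.

Set Implicit Arguments.
Unset Strict Implicit.
Unset Printing Implicit Defensive.

Import Order.TTheory GRing.Theory Num.Theory.
Import numFieldNormedType.Exports.
Local Open Scope classical_set_scope.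
Local Open Scope ring_scope.

(** * The topological invariant *)

(** Cantor-Bendixson derivatives, started from the closure of the isolated points because in the
    whole space the perfect set [K] would hide the ranks of the [c_n]. *)
Fixpoint isolated_rank {X : topologicalType} (n : nat) : set X :=
  if n is n'.+1 then limit_point (isolated_rank n')
  else closure [set x : X | nbhs x [set x]].

(** The closure condition singles out the tops of the spikes, since lower points of a spike have
    finite ranks too. *)
Definition rank_spectrum (X : topologicalType) : set nat :=
  [set m | exists x : X, [/\ isolated_rank m x, ~ isolated_rank m.+1 x &
                            closure (~` isolated_rank 0) x]].

Lemma isolated_rank_homeo (X Y : topologicalType) (f : X -> Y) (g : Y -> X) :
  cancel f g -> cancel g f -> continuous f -> continuous g ->
  forall n x, isolated_rank n x -> isolated_rank n (f x).
Proof.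
move=> fK gK cf cg; elim=> [|n IHn] x /=.
  move=> clx B /cf /clx [y [/= isoy By]]; exists (f y); split => //=.
  have := cg (f y) [set y]; rewrite fK => /(_ isoy) /=.
  by apply: (@filterS _ (nbhs (f y))) => w /= <-; rewrite gK.
move=> lx B /cf /lx [y [yx Ly By]]; exists (f y); split; [|exact: IHn|exact: By].
by apply: contra_neq yx => /(can_inj fK).
Qed.

Lemma rank_spectrum_homeo (X Y : topologicalType) :
  homeomorphic X Y -> rank_spectrum X `<=` rank_spectrum Y.
Proof.
move=> [f [g [fK gK cf cg]]] m [x [Lx nLx clx]]; exists (f x); split.
- exact: (isolated_rank_homeo fK gK cf cg).
- by move=> /(isolated_rank_homeo gK fK cg cf); rewrite fK.
- move=> B /cf /clx [y [nLy By]]; exists (f y); split => //.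
  by move=> /(isolated_rank_homeo gK fK cg cf); rewrite fK.
Qed.

(** A limit point of a closure lies in that closure; monotonicity of [limit_point] carries this to
    all ranks. *)
Lemma isolated_rank_anti {X : topologicalType} (m n : nat) (x : X) :
  (m <= n)%N -> isolated_rank n x -> isolated_rank m x.
Proof.
move=> /subnK <-; elim: (n - m)%N => // k IHk Lx; apply: IHk.
move: Lx; rewrite addSn; move: (k + m)%N x => {}n.
elim: n => [|n IHn] x Lx B Bx.
  have [y [_ Ly By]] := Lx _ (nbhs_interior Bx).
  by have [z [? ?]] := Ly _ By; exists z.
by have [y [yx Ly By]] := Lx _ Bx; exists y; split => //; apply: IHn.
Qed.

(** * Binary sequences and their marks *)

Implicit Types z w : nat -> bool.

Definition agree (N : nat) (z w : nat -> bool) : Prop :=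
  forall i, (i < N)%N -> z i = w i.

Lemma agree_le (M N : nat) (z w : nat -> bool) :
  (M <= N)%N -> agree N z w -> agree M z w.
Proof. by move=> MN zw i iM; apply/zw/(leq_trans iM). Qed.

(** Marks measure depth in a spike: over [c_n], a point with [k] marks in all will have rank
    [f n - k]. *)
Definition marks (z : nat -> bool) (N : nat) : nat :=
  (\sum_(i < N) (odd i && z i))%N.

Lemma marksS z N : marks z N.+1 = (marks z N + (odd N && z N))%N.
Proof. by rewrite /marks big_ord_recr. Qed.

Lemma marks_le z M N : (M <= N)%N -> (marks z M <= marks z N)%N.
Proof.
move=> /subnK <-; elim: (N - M)%N => // k /leq_trans; apply.
by rewrite addSn marksS leq_addr.
Qed.

Lemma marks_agree z w N : agree N z w -> marks z N = marks w N.
Proof. by move=> zw; apply: eq_bigr => i _; rewrite zw. Qed.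

Lemma marks_eq_ge z N M i :
  (N <= i)%N -> (i < M)%N -> (marks z M <= marks z N)%N -> odd i -> ~~ z i.
Proof.
move=> Ni iM MN oi; apply/negP => zi.
have := leq_trans (marks_le z iM) MN; rewrite marksS oi zi addn1.
by rewrite ltnNge marks_le.
Qed.

(** Induction on the bound: either [b] still bounds the counts, or [b.+1] is reached and kept. *)
Lemma marks_stationary z b : (forall N, (marks z N <= b)%N) ->
  exists N0, forall N, (N0 <= N)%N -> marks z N = marks z N0.
Proof.
elim: b => [|b IHb] zb.
  exists 0%N => N _; apply/eqP; rewrite eqn_leq [X in _ && X]marks_le // andbT.
  by apply: leq_trans (zb N) _.
have [/IHb//|] := pselect (forall N, (marks z N <= b)%N).
move=> /existsNP[N0 /negP]; rewrite -ltnNge => bN0; exists N0 => N N0N.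
apply/eqP; rewrite eqn_leq [X in _ && X]marks_le // andbT.
by apply: leq_trans (zb N) _.
Qed.

Definition put (z : nat -> bool) (i : nat) : nat -> bool :=
  fun k => (k == i) || z k.

Lemma put_agree z i N : (N <= i)%N -> agree N z (put z i).
Proof. by move=> Ni k kN; rewrite /put ltn_eqF // (leq_trans kN). Qed.

Lemma marks_put z i N : odd i -> ~~ z i ->
  marks (put z i) N = (marks z N + (i < N))%N.
Proof.
move=> oi zi; elim: N => [|N IHN]; first by rewrite /marks !big_ord0.
rewrite !marksS IHN /put ltnS [(i <= N)%N]leq_eqVlt [N == i]eq_sym.
case: eqVneq => [<-/=|_ /=].
  by rewrite oi ltnn (negbTE zi) !addn0.
by rewrite addnAC.
Qed.

(* [K] is the set of sequences vanishing at all odd indices, and [c_n] is the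
   indicator of [2n].  The spike at [c_n] adds at most [f n] ones, at odd indices
   beyond [2n]; the latter bound makes the spikes shrink.  It is phrased through
   conditions that each bear on finitely many digits, hence closed. *)
Definition spiked (f : nat -> nat) : set (nat -> bool) := [set z : nat -> bool |
  [/\ forall i, odd i -> z i -> exists n, (n.*2 < i)%N && z n.*2,
      forall i n k, odd i -> z i -> z n.*2 -> z k.*2 -> n = k &
      forall n N, z n.*2 -> (marks z N <= f n)%N]].

(** For a point of [spiked f], this says that it lies in the spike at [c_n]. *)
Definition only_even (z : nat -> bool) (n : nat) : Prop :=
  forall k, z k.*2 = (k == n).

(** * Points of the spikes *)

Section spiked_space.
Variable f : nat -> nat.
Hypothesis f_gt : forall n, (n < f n)%N.

Lemma spiked_no_mark z : (forall i, odd i -> z i = false) -> spiked f z.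
Proof.
move=> z0; split => [i /z0->//|i n k /z0->//|n N _].
by rewrite /marks big1 // => i _; case: (boolP (odd i)) => // /z0 ->.
Qed.

Lemma spiked_only_even z i : spiked f z -> odd i -> z i ->
  exists n, only_even z n.
Proof.
move=> [z1 z2 _] oi zi; have [n /andP[ni zn]] := z1 _ oi zi.
exists n => k; apply/idP/eqP => [zk|->//]; exact: (z2 i).
Qed.

Lemma spiked_put z n i : spiked f z -> only_even z n -> odd i -> (n.*2 < i)%N ->
  ~~ z i -> (forall N, marks z N < f n)%N ->
  spiked f (put z i) /\ only_even (put z i) n.
Proof.
move=> [z1 z2 z3] zn oi ni zi zf.
have pn : only_even (put z i) n.
  by move=> k; rewrite /put zn; case: eqP => // ki; rewrite -ki odd_double in oi.
split=> //; split.
- move=> j oj; rewrite /put => /orP[/eqP->|/(z1 _ oj)[k /andP[kj zk]]].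
    by exists n; rewrite ni zn eqxx orbT.
  by exists k; rewrite kj zk orbT.
- by move=> j k l _ _; rewrite !pn => /eqP-> /eqP->.
- move=> k N; rewrite pn => /eqP->; rewrite marks_put //.
  apply: leq_trans (zf N); rewrite -[X in (_ <= X)%N]addn1.
  by rewrite leq_add2l leq_b1.
Qed.

(** Beyond [N] neither sequence has a mark, and [n] determines the even digits. *)
Lemma only_even_eq z w n N : spiked f z -> spiked f w ->
  only_even z n -> only_even w n -> agree N z w ->
  (forall M, marks z M <= marks z N)%N -> (forall M, marks w M <= marks w N)%N ->
  z = w.
Proof.
move=> Az Aw zn wn zw zN wN; apply/funext => i.
have [/zw//|Ni] := ltnP i N.
have [oi|ei] := boolP (odd i).
  rewrite (negbTE (marks_eq_ge Ni (ltnSn i) (zN _) oi)).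
  by rewrite (negbTE (marks_eq_ge Ni (ltnSn i) (wN _) oi)).
by rewrite -[i]odd_double_half (negbTE ei) add0n zn wn.
Qed.

(** * Ranks in any space that [d] identifies with [spiked f] *)

Variables (X : topologicalType) (d : X -> nat -> bool).
Hypothesis d_inj : injective d.
Hypothesis d_spiked : forall x, spiked f (d x).
Hypothesis d_onto : forall z, spiked f z -> exists x, d x = z.
Hypothesis d_nbhs : forall x (U : set X),
  nbhs x U <-> exists N, forall y, agree N (d x) (d y) -> U y.

Let cyl_nbhs x N : nbhs x [set y | agree N (d x) (d y)].
Proof. by apply/d_nbhs; exists N. Qed.

(** Flipping the even digit [2N] of a point without marks gives another such point in the same
    cylinder. *)
Lemma isolated_mark (x : X) : nbhs x [set x] -> exists2 i, odd i & d x i.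
Proof.
move=> /d_nbhs[N HN]; apply: contrapT => nx.
have x0 i : odd i -> d x i = false.
  by move=> oi; apply/negbTE/negP => xi; apply: nx; exists i.
pose w i := if i == N.*2 then ~~ d x i else d x i.
have [y yE] : exists y, d y = w.
  apply/d_onto/spiked_no_mark => i oi; rewrite /w x0 //.
  by case: eqP => // iN; rewrite iN odd_double in oi.
have : y = x.
  apply: HN => i iN; rewrite yE /w ltn_eqF //.
  by rewrite (leq_trans iN) // -addnn leq_addr.
move=> yx; have := congr1 (fun z => z N.*2) yE; rewrite yx /w eqxx.
by case: (d x _).
Qed.

(** [x] shares both digits with an isolated point, whose mark allows only one even one. *)
Lemma isolated_rank0_even (x : X) n k :
  isolated_rank 0 x -> d x n.*2 -> d x k.*2 -> n = k.
Proof.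
move=> /= /(_ _ (cyl_nbhs x (maxn n.*2 k.*2).+1)) [y [/= isoy xy]] xn xk.
have [i oi yi] := isolated_mark isoy.
have [_ y2 _] := d_spiked y; apply: (y2 i) => //.
  by rewrite -xy // ltnS leq_maxl.
by rewrite -xy // ltnS leq_maxr.
Qed.

(* A point with [k] marks is a limit of points with [k + 1] marks, as long as
   [k < f n], and of no other points of its spike. *)
Lemma only_even_isolated_rank (x : X) n N : only_even (d x) n ->
  (forall M, (marks (d x) M <= marks (d x) N)%N) ->
  forall j, isolated_rank j x <-> (j + marks (d x) N <= f n)%N.
Proof.
have stat x' n' : only_even (d x') n' ->
    exists N0, forall N, (N0 <= N)%N -> marks (d x') N = marks (d x') N0.
  move=> x'n; apply: (@marks_stationary _ (f n')) => M.
  by have [_ _] := d_spiked x'; apply; rewrite x'n.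
move=> xn xN j; split.
  elim: j x N xn xN => [|j IHj] x N xn xN.
    by move=> _; have [_ _ x3] := d_spiked x; apply: x3; rewrite xn.
  (* This cylinder fixes all marks of [x] and the digit [2n], so [y] is in the same spike and, being
     distinct from [x], has a further mark. *)
  move=> /(_ _ (cyl_nbhs x (maxn N n.*2.+1))) [y [yx Ly /= xy]].
  have xyN : agree N (d x) (d y) by apply: agree_le xy; rewrite leq_maxl.
  have yn : d y n.*2 by rewrite -xy ?leq_maxr // xn eqxx.
  have {}yn : only_even (d y) n.
    move=> k; apply/idP/eqP => [yk|->//].
    by apply: isolated_rank0_even yk yn; apply: isolated_rank_anti Ly.
  have [N0 yN0] := stat _ _ yn.
  have yN0' M : (marks (d y) M <= marks (d y) N0)%N.
    by rewrite -(yN0 (maxn M N0)) ?leq_maxr // marks_le // leq_maxl.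
  apply: leq_trans (IHj _ N0 yn yN0' Ly).
  rewrite addSnnS leq_add2l ltnNge; apply: contra yx => yN.
  apply/eqP/d_inj/esym/(@only_even_eq _ _ n N) => // M.
  by rewrite -(marks_agree xyN); apply: leq_trans yN.
have add y M K : only_even (d y) n -> (marks (d y) M < f n)%N ->
    (forall K, (marks (d y) K <= marks (d y) M)%N) ->
    exists w : X, [/\ w != y, agree K (d y) (d w), only_even (d w) n &
      exists M', marks (d w) M' = (marks (d y) M).+1 /\
        forall K, (marks (d w) K <= marks (d w) M')%N].
  (* The new mark goes to an odd index beyond [M], [K] and [2n]. *)
  move=> yn yf yM; pose L := maxn (maxn M K) n.*2; pose i := L.*2.+1.
  have oi : odd i by rewrite /= odd_double.
  have ile m : (m <= L)%N -> (m < i)%N.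
    by rewrite ltnS -addnn => /leq_trans; apply; rewrite leq_addr.
  have yi : ~~ d y i.
    apply: (@marks_eq_ge _ M i.+1) => //.
    by rewrite ltnW // ile // /L !leq_max leqnn.
  have [] := @spiked_put (d y) n i (d_spiked y) yn oi _ yi.
  - by rewrite ile // /L leq_maxr.
  - by move=> M'; apply: leq_ltn_trans (yM M') yf.
  move=> /d_onto[w wE] wn; exists w; rewrite wE; split => //.
  - apply: contraNneq yi => wy; rewrite -wy wE /put eqxx //.
  - by apply: put_agree; rewrite ltnW // ile // /L !leq_max leqnn orbT.
  - have Mi : marks (put (d y) i) i.+1 = (marks (d y) M).+1.
      rewrite marks_put // ltnSn addn1; congr S; apply/eqP.
      by rewrite eqn_leq yM marks_le // ltnW // ltnS ltnW // ile // /L !leq_max leqnn.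
    exists i.+1; split => // M'; rewrite Mi marks_put // -[X in (_ <= X)%N]addn1.
    by rewrite leq_add // leq_b1.
elim: j x N xn xN => [|j IHj] x N xn xN.
  (* Induction on the number [k] of marks still available: at [k = 0] the point is isolated,
     otherwise a point with one more mark is arbitrarily near. *)
  rewrite add0n => xf; move kE : (f n - marks (d x) N)%N => k.
  elim: k x N xn xN xf kE => [|k IHk] x N xn xN xf kE U.
    move=> /nbhs_singleton Ux; exists x; split => //=.
    have xfn : marks (d x) N = f n by apply/eqP; rewrite eqn_leq xf -subn_eq0 kE /=.
    apply/d_nbhs; exists (maxn N n.*2.+1) => y xy.
    have xyN : agree N (d x) (d y) by apply: agree_le xy; rewrite leq_maxl.
    have yn : d y n.*2 by rewrite -xy ?leq_maxr // xn eqxx.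
    have yf : marks (d y) N = f n by rewrite -(marks_agree xyN).
    have yM M : (marks (d y) M <= marks (d y) N)%N.
      by rewrite yf; have [_ _] := d_spiked y; apply.
    (* As [f n > 0], [y] has a mark, which confines it to one spike. *)
    have [i oi yi] : exists2 i, odd i & d y i.
      apply: contrapT => ny; have := f_gt n; rewrite -yf /marks big1 //= => i _.
      have [oi|//] := boolP (odd i); apply/eqP; rewrite eqb0; apply/negP => yi.
      by apply: ny; exists i.
    have [n' yn'] := spiked_only_even (d_spiked y) oi yi.
    move: yn; rewrite yn' => /eqP nn'; rewrite -nn' in yn'.
    by apply/d_inj/esym/(@only_even_eq _ _ n N).
  move=> Ux; move: (Ux) => /d_nbhs[K KU].
  have xf' : (marks (d x) N < f n)%N by rewrite -subn_gt0 kE.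
  have [w [_ xw wn [M' [wM' wM]]]] := add x N K xn xf' xN.
  apply: (IHk w M') => //; rewrite ?wM' //; first by rewrite subnS kE.
  by apply/d_nbhs; exists K => y wy; apply: KU => i iK; rewrite xw // wy.
rewrite addSnnS => xf U /d_nbhs[K KU].
have xf' : (marks (d x) N < f n)%N by apply: leq_trans xf; rewrite leq_addl.
have [w [wx xw wn [M' [wM' wM]]]] := add x N K xn xf' xN.
exists w; split => //; last exact: KU.
by apply: (IHj w M') => //; rewrite wM'.
Qed.

(** These points are the tops [c_n]. *)
Let peak n : exists x, d x = fun k => k == n.*2.
Proof.
apply/d_onto/spiked_no_mark => i oi; apply/negbTE/negP => /eqP iE.
by rewrite iE odd_double in oi.
Qed.

Let peak_only n x : d x = (fun k => k == n.*2) -> only_even (d x) n.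
Proof. by move=> -> k; rewrite -!mul2n eqn_pmul2l. Qed.

Let peak_rank n x : d x = (fun k => k == n.*2) ->
  forall j, isolated_rank j x <-> (j <= f n)%N.
Proof.
move=> xE j.
have x0 M : marks (d x) M = 0%N.
  rewrite /marks big1 // => i _; rewrite xE; case: eqP => [->|_].
    by rewrite odd_double.
  by rewrite andbF.
have := @only_even_isolated_rank x n 0 (peak_only xE) _ j.
by rewrite x0 addn0; apply => M; rewrite !x0.
Qed.

Lemma rank_spectrumE : rank_spectrum X = range f.
Proof.
apply/seteqP; split=> [m [x [Lx nLx clx]]|_ [n _ <-]].
  (* Around a marked point, a whole cylinder consists of spike points, all in [isolated_rank 0]. *)
  have x0 i : odd i -> d x i = false.
    move=> oi; apply/negbTE/negP => xi.
    have [y [nLy /= xy]] := clx _ (cyl_nbhs x i.+1).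
    apply: nLy; have yi : d y i by rewrite -xy.
    have [n yn] := spiked_only_even (d_spiked y) oi yi.
    have yf N : (marks (d y) N <= f n)%N.
      by have [_ _] := d_spiked y; apply; rewrite yn.
    have [N yN] := marks_stationary yf.
    apply/(@only_even_isolated_rank y n N yn); last by rewrite add0n.
    move=> M; rewrite -(yN (maxn M N)) ?leq_maxr // marks_le // leq_maxl //.
  have L0x : isolated_rank 0 x by apply: isolated_rank_anti Lx.
  (* Otherwise [x] is the zero sequence, a limit of tops of rank at least [m]: in [maxn N m], [N]
     gives closeness and [m] gives rank. *)
  have [n xn] : exists n, d x n.*2.
    apply: contrapT => nx; apply: nLx => /= U /d_nbhs[N NU].
    have xE i : d x i = false.
      have [/x0//|ei] := boolP (odd i).
      apply/negbTE/negP => xi; apply: nx; exists i./2.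
      by move: xi; rewrite -[in d x i](odd_double_half i) (negbTE ei).
    have [y yE] := peak (maxn N m); exists y; split.
    - apply: contraTneq isT => yx; have := xE (maxn N m).*2.
      by rewrite -yx yE eqxx.
    - apply/(peak_rank yE); apply: leq_trans (ltnW (f_gt _)).
      by rewrite leq_maxr.
    - apply: NU => i iN; rewrite xE yE ltn_eqF // (leq_trans iN) //.
      by rewrite -addnn (leq_trans (leq_maxl N m)) ?leq_addr.
  have xE : d x = (fun k => k == n.*2).
    apply/funext => i; apply/idP/eqP => [xi|->//].
    have ei : ~~ odd i by apply/negP => /x0; rewrite xi.
    move: (xi); rewrite -[i]odd_double_half (negbTE ei) add0n => xi'.
    by rewrite (isolated_rank0_even L0x xi' xn).
  exists n => //; apply/eqP; rewrite eqn_leq; apply/andP; split.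
    rewrite leqNgt; apply/negP => mf; apply: nLx; exact/(peak_rank xE).
  exact/(peak_rank xE).
have [x xE] := peak n; exists x; split; first exact/(peak_rank xE).
  by move=> /(peak_rank xE); rewrite ltnn.
(* A second even one, far out and at [k > n], leaves the closure of the isolated points. *)
move=> U /d_nbhs[N NU]; pose k := (maxn N n.+1).
have [y yE] : exists y, d y = put (d x) k.*2.
  apply/d_onto/spiked_no_mark => i oi; rewrite /put xE.
  by apply/negbTE/negP => /orP[] /eqP iE; rewrite iE odd_double in oi.
exists y; split; last first.
  apply: NU; rewrite yE; apply: put_agree.
  by rewrite -addnn (leq_trans (leq_maxl N n.+1)) ?leq_addr.
move=> L0y; have : n = k.
  apply: (isolated_rank0_even L0y); rewrite yE /put ?eqxx //.
  by rewrite xE eqxx orbT.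
by move=> nk; have := leq_maxr N n.+1; rewrite -/k -nk ltnn.
Qed.

End spiked_space.

(** * Ternary embedding of the Cantor space in the unit interval *)

Section ternary.
Variable R : realType.

Definition ternary_sum z (N : nat) : R :=
  \sum_(i < N) (z i)%:R * 2 * 3^-1 ^+ i.+1.

(** The partial sums are nondecreasing, so this supremum is the sum of the series. *)
Definition ternary z : R := sup (range (ternary_sum z)).

Lemma ternary_sumS z N :
  ternary_sum z N.+1 = ternary_sum z N + (z N)%:R * 2 * 3^-1 ^+ N.+1.
Proof. by rewrite /ternary_sum big_ord_recr. Qed.

Lemma ternary_sum_le z M N : (M <= N)%N -> ternary_sum z M <= ternary_sum z N.
Proof.
move=> /subnK <-; elim: (N - M)%N => // k /le_trans; apply.
by rewrite addSn ternary_sumS lerDl !mulr_ge0 ?exprn_ge0.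
Qed.

Lemma ternary_sum_le_tail z M N :
  ternary_sum z M <= ternary_sum z N + 3^-1 ^+ N.
Proof.
have [MN|NM] := leqP M N.
  by rewrite (le_trans (ternary_sum_le z MN)) // lerDl exprn_ge0.
rewrite -(subnK (ltnW NM)); set k := (M - N)%N.
(* Subtracting the remaining tail makes the bound inductive. *)
suff : ternary_sum z (k + N) <= ternary_sum z N + 3^-1 ^+ N - 3^-1 ^+ (k + N).
  by move=> /le_trans; apply; rewrite gerBl exprn_ge0.
elim: k => [|k IHk]; first by rewrite add0n addrK.
rewrite addSn ternary_sumS.
have : (z (k + N)%N)%:R * 2 * 3^-1 ^+ (k + N).+1 <=
    3^-1 ^+ (k + N) - 3^-1 ^+ (k + N).+1 :> R.
  rewrite exprS; have : 0 <= 3^-1 ^+ (k + N) :> R by rewrite exprn_ge0.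
  by case: (z _) => /=; lra.
by move: IHk; lra.
Qed.

Lemma ternary_ge z N : ternary_sum z N <= ternary z.
Proof.
apply: ub_le_sup; last by exists N.
by exists (ternary_sum z 0 + 3^-1 ^+ 0) => _ [M _ <-]; apply: ternary_sum_le_tail.
Qed.

Lemma ternary_le z N : ternary z <= ternary_sum z N + 3^-1 ^+ N.
Proof.
apply: ge_sup; first by exists (ternary_sum z 0), 0%N.
by move=> _ [M _ <-]; apply: ternary_sum_le_tail.
Qed.

Lemma ternary_itv z : ternary z \in `[0, 1].
Proof.
have := ternary_ge z 0; have := ternary_le z 0.
by rewrite /ternary_sum big_ord0 expr0 add0r in_itv /= => -> ->.
Qed.

Lemma ternary_sum_agree z w N :
  agree N z w -> ternary_sum z N = ternary_sum w N.
Proof. by move=> zw; apply: eq_bigr => i _; rewrite zw. Qed.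

Lemma ternary_agree z w N :
  agree N z w -> `|ternary z - ternary w| <= 3^-1 ^+ N.
Proof.
move=> /ternary_sum_agree zw; rewrite ler_norml.
have := ternary_ge z N; have := ternary_le z N.
have := ternary_ge w N; have := ternary_le w N.
by rewrite zw; lra.
Qed.

(** The digit contributes twice [3^-1 ^+ N.+1], while the tail is at most once that. *)
Lemma ternary_lt z w N : agree N z w -> ~~ z N -> w N -> ternary z < ternary w.
Proof.
move=> zw zN wN; apply: le_lt_trans (ternary_le z N.+1) _.
apply: lt_le_trans (ternary_ge w N.+1).
rewrite !ternary_sumS (negbTE zN) wN (ternary_sum_agree zw) !mul0r addr0.
by rewrite ltrD2l mul1r mulr_natl mulr2n ltrDl exprn_gt0.
Qed.

Lemma ternary_inj : injective ternary.
Proof.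
move=> z w zw; apply/funext; apply: contrapT => /existsNP[i zwi].
have ex : exists i, z i != w i by exists i; apply/eqP.
have [N zwN minN] := ex_minnP ex.
have agr : agree N z w.
  by move=> k kN; apply/eqP/negPn/negP => /minN; rewrite leqNgt kN.
move: zwN; case zN: (z N); case wN: (w N) => // _.
  have agr' : agree N w z by move=> k /agr.
  by have := ternary_lt agr' (negbT wN) zN; rewrite zw ltxx.
by have := ternary_lt agr (negbT zN) wN; rewrite zw ltxx.
Qed.

Lemma expr3_lt (e : R) : 0 < e -> exists N, 3^-1 ^+ N < e.
Proof.
move=> e0; have : (3^-1 : R) ^+ n @[n --> \oo] --> (0 : R).
  by apply: cvg_expr; rewrite ger0_norm; lra.
move=> /cvgrPdist_lt/(_ _ e0) [N _ /(_ N (leqnn N))].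
by rewrite sub0r normrN ger0_norm ?exprn_ge0 // => ?; exists N.
Qed.

Lemma cantor_cylinder_nbhs (z : cantor_space) N :
  nbhs z [set w : cantor_space | agree N z w].
Proof.
elim: N => [|N IHN]; first by apply: filterE => w i.
have zN : nbhs z [set w : cantor_space | z N = w N].
  have := @proj_continuous nat (fun=> bool) N z [set b | z N = b].
  by apply; apply: open_nbhs_nbhs; split; [exact: discrete_open|].
apply: filterS (filterI IHN zN) => w [/= zw zwN] i.
by rewrite ltnS leq_eqVlt => /predU1P[->|/zw].
Qed.

Lemma ternary_continuous : continuous (ternary : cantor_space -> R).
Proof.
move=> z; apply/cvgrPdist_lt => e e0.
have [N Ne] := expr3_lt e0.
apply: filterS (cantor_cylinder_nbhs z N) => w /ternary_agree /le_lt_trans.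
exact.
Qed.

Lemma closed_cantor (A : set cantor_space) :
  (forall z, ~ A z -> exists N, forall w, agree N z w -> ~ A w) -> closed A.
Proof.
move=> clA z clz; apply: contrapT => /clA [N NA].
by have [w [Aw /NA]] := clz _ (cantor_cylinder_nbhs z N).
Qed.

Lemma compact_ternary (A : set cantor_space) :
  closed A -> compact (ternary @` A).
Proof.
move=> clA; apply: continuous_compact.
  by apply: continuous_subspaceT; exact: ternary_continuous.
by apply: subclosed_compact cantor_space_compact _.
Qed.

Lemma closed_ternary (A : set cantor_space) :
  closed A -> closed (ternary @` A).
Proof. by move=> /compact_ternary/compact_closed; apply; exact: norm_hausdorff. Qed.

(** Two distinct points differ at some digit [i], and the value of that digit splits the image into
    two relatively clopen parts. *)
Lemma totally_disconnected_ternary (A : set cantor_space) :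
  totally_disconnected (ternary @` A).
Proof.
move=> x Ax; apply/seteqP; split; last first.
  by move=> _ ->; exact: connected_component_refl.
move=> y [C [Cx CA Cconn] Cy]; apply: contrapT => /= yx.
have [z _ zx] := Ax; have [w _ wy] := CA _ Cy.
have /existsNP[i zwi] : ~ forall i, z i = w i.
  by move=> /funext zw; apply: yx; rewrite -zx -wy zw.
have clb b : closed (ternary @` [set u : cantor_space | u i = b]).
  apply: closed_ternary; apply: closed_cantor => u /= ub; exists i.+1 => v uv.
  by rewrite /= -uv.
have disj b u : (ternary @` [set u : cantor_space | u i = b]) (ternary u) -> u i = b.
  by move=> [v <- /ternary_inj ->].
have CE : C `&` ternary @` [set u : cantor_space | u i = z i] = C.
  apply: Cconn.
  - by exists x; split => //; exists z.
  (* Relative openness: the part is the trace of the complement of the other closed part. *)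
  - exists (~` (ternary @` [set u : cantor_space | u i = ~~ z i])).
      by apply: closed_openC.
    apply/seteqP; split=> t [Ct tz]; split=> //.
      by move: tz => [u uz <-] /disj; rewrite uz; case: (z i).
    have [u _ ut] := CA _ Ct; exists u => //=.
    case: (eqVneq (u i) (z i)) => // uz; exfalso; apply: tz; exists u => //=.
    by case: (u i) (z i) uz => [] [].
  - by exists (ternary @` [set u : cantor_space | u i = z i]).
have : C y by [].
by rewrite -CE => -[_]; rewrite -wy => /disj/esym.
Qed.

(* Cylinders are neighborhoods because the rest of [A] has a compact, hence closed,
   image. *)
Lemma ternary_nbhs (A : set cantor_space) (d : ternary @` A -> nat -> bool) :
  closed A -> (forall x, ternary (d x) = set_val x) ->
  forall x (U : set (ternary @` A)),
  nbhs x U <-> exists N, forall y, agree N (d x) (d y) -> U y.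
Proof.
move=> clA dE x U; split.
  move=> [_ [[V oV <-] /= Vx VU]].
  have /nbhs_ballP[e /= e0 eV] : nbhs (ternary (d x)) V.
    by rewrite dE; exact: open_nbhs_nbhs.
  have [N Ne] := expr3_lt e0; exists N => y xy; apply: VU => /=.
  rewrite -dE; apply: eV; rewrite /ball /=.
  exact: le_lt_trans (ternary_agree xy) Ne.
move=> [N NU].
pose B := A `&` [set w : cantor_space | ~ agree N (d x) w].
have clB : closed B.
  apply: closedI => //; apply: closed_cantor => w /= /contrapT xw.
  exists N => v wv nxv; apply: nxv => i iN; rewrite xw // wv //.
have /closed_ternary/closed_openC oB := clB.
exists (set_val @^-1` (~` (ternary @` B))); split => /=.
- by exists (~` (ternary @` B)).
- by move=> [w [_ nxw]]; rewrite -dE => /ternary_inj wx; apply: nxw; rewrite wx.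
- move=> y nBy; apply: NU; apply: contrapT => xy; apply: nBy.
  exists (d y); last exact: dE.
  split => //; have /set_mem [w Aw wy] := valP y.
  by rewrite -(ternary_inj (etrans wy (esym (dE y)))).
Qed.

End ternary.

(** * The spiked sets inside the real line *)

Lemma closed_spiked f : closed (spiked f : set cantor_space).
Proof.
apply: closed_cantor => z /not_and3P[].
(* The index sought lies below [i], so failure shows on the first [i.+1] digits. *)
- move=> /existsNP[i /not_implyP[oi /not_implyP[zi nz]]]; exists i.+1.
  move=> w zw [/(_ i oi)]; rewrite -zw // => /(_ zi) [n /andP[ni wn]] _ _.
  by apply: nz; exists n; rewrite ni zw // ltnS ltnW.
- move=> /existsNP[i /existsNP[n /existsNP[k]]].
  move=> /not_implyP[oi /not_implyP[zi /not_implyP[zn /not_implyP[zk nk]]]].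
  exists (maxn i (maxn n.*2 k.*2)).+1 => w zw [_ w2 _].
  by apply/nk/(w2 i); rewrite -?zw // ltnS !leq_max leqnn ?orbT.
- move=> /existsNP[n /existsNP[N /not_implyP[zn nz]]].
  exists (maxn N n.*2.+1) => w zw [_ _ w3]; apply: nz.
  rewrite (@marks_agree z w).
    by apply: w3; rewrite -zw // leq_max leqnn orbT.
  by apply: agree_le zw; rewrite leq_maxl.
Qed.

Lemma rank_spectrum_spiked (R : realType) f : (forall n, (n < f n)%N) ->
  rank_spectrum (set_type (ternary R @` spiked f)) = range f.
Proof.
move=> f_gt; set A := ternary R @` _.
(* [d] reads off the digits of each point, as the abstract computation of ranks requires. *)
have /choice[d dP] (x : A) : exists z, spiked f z /\ ternary R z = set_val x.
  by have /set_mem[z ? ?] := valP x; exists z.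
apply: (@rank_spectrumE f f_gt A d).
- move=> x y xy; apply: val_inj.
  by have [_ dx] := dP x; have [_ dy] := dP y; rewrite -[LHS]dx xy dy.
- by move=> x; have [] := dP x.
- move=> z Az; have Ax : ternary R z \in A by apply/mem_set; exists z.
  exists (SigSub Ax); apply: (@ternary_inj R).
  by have [_ ->] := dP (SigSub Ax).
- apply: ternary_nbhs; first exact: closed_spiked.
  by move=> x; have [] := dP x.
Qed.

(** * Coding reals by Dedekind cuts *)

Section cut.
Variable R : realType.

(** Rationals are enumerated by [pickle]; [false] is the default at non-codes. *)
Definition in_cut (r : R) (n : nat) : bool :=
  if unpickle n is Some q then ratr (q : rat) < r else false.

(** [n] and the cut bit can both be recovered from the value, the bit being its parity. *)
Definition cut_code (r : R) (n : nat) : nat := (n.*2.+1 + in_cut r n)%N.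

Lemma cut_code_gt r n : (n < cut_code r n)%N.
Proof. by rewrite /cut_code addSn ltnS -addnn -addnA leq_addr. Qed.

(** A rational [q] with [r < q < s] puts an even value in the range for [s] that the range for [r]
    misses. *)
Lemma range_cut_code_inj r s : range (cut_code r) = range (cut_code s) -> r = s.
Proof.
wlog rs : r s / r < s => [hw rsE|].
  by case: (ltgtP r s) => // [/hw->//|/hw -> //].
have [q] := rat_in_itvoo rs; rewrite in_itv /= => /andP[rq qs] rsE.
have : range (cut_code s) (cut_code s (pickle q)) by exists (pickle q).
rewrite -rsE => -[m _].
rewrite /cut_code {2}/in_cut pickleK qs.
case mr: (in_cut r m) => /= mq; last first.
  by have := congr1 odd mq; rewrite addn0 addn1 /= !odd_double.
have mq' : m = pickle q by apply: double_inj; move: mq; rewrite !addn1 => -[].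
by move: mr; rewrite mq' /in_cut pickleK ltNge ltW.
Qed.

End cut.

Theorem theorem4 (R : realType) :
  exists F : set (set R),
    [/\ (F #= [set: R])%card,
        forall A : set R, F A ->
          [/\ A `<=` `[0, 1]%classic, compact A & totally_disconnected A] &
        forall A B : set R, F A -> F B -> A <> B ->
          ~ homeomorphic (set_type A) (set_type B)].
Proof.
pose X (r : R) : set R := ternary R @` (spiked (cut_code r) : set cantor_space).
have X_homeo r s : homeomorphic (set_type (X r)) (set_type (X s)) -> r = s.
  move=> [f [g [fK gK cf cg]]]; apply: range_cut_code_inj.
  rewrite -!(rank_spectrum_spiked R (cut_code_gt _)).
  by apply/seteqP; split; apply: rank_spectrum_homeo; [exists f, g|exists g, f].
(* Equal sets are homeomorphic by the identity, so distinct reals give distinct sets. *)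
have X_inj : injective X.
  move=> r s rs; apply: X_homeo; rewrite rs; exists id, id.
  by split=> // x; exact: cvg_id.
exists (range X); split.
- by apply: inj_card_eq => r s _ _; exact: X_inj.
- move=> _ [r _ <-]; split.
  + by move=> _ [z _ <-]; exact: ternary_itv.
  + by apply: compact_ternary; exact: closed_spiked.
  + exact: totally_disconnected_ternary.
- by move=> _ _ [r _ <-] [s _ <-] nrs /X_homeo rs; apply: nrs; rewrite rs.
Qed.
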